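(* Oriented twin-width and twin-width are functionally equivalent: there is a function $f:\mathbb N\to\mathbb N$ such that for every finite graph $G$, $\mathrm{otww}(G)\le f(\mathrm{tww}(G))$ and $\mathrm{tww}(G)\le f(\mathrm{otww}(G))$.
   Context: Graphs are finite and simple. A partition sequence of an $n$-vertex graph $G$ is a sequence $\mathcal P_n,\dots,\mathcal P_1$ of partitions of $V(G)$ where $\mathcal P_n$ consists of singletons, $\mathcal P_1=\{V(G)\}$, and each $\mathcal P_i$ is obtained from $\mathcal P_{i+1}$ by merging two parts. Two disjoint vertex sets $X,Y$ are homogeneous if all or none of the pairs $x\in X$, $y\in Y$ are edges. For a partition $\mathcal P$, the red graph has vertex set $\mathcal P$ and an edge between distinct parts that are not homogeneous; the directed red graph has vertex set $\mathcal P$ and an arc $X\to Y$ between distinct parts whenever some vertex of $Y$ has both a neighbor and a non-neighbor in $X$. The twin-width $\mathrm{tww}(G)$ is the minimum over partition sequences of $\max_i$ of the maximum degree of the red graph of $\mathcal P_i$. The oriented twin-width $\mathrm{otww}(G)$ is the minimum over partition sequences of $\max_i$ of the maximum out-degree of the directed red graph of $\mathcal P_i$. *)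

(* Defs.v *)
From mathcomp Require Import all_boot.

Set Implicit Arguments.
Unset Strict Implicit.
Unset Printing Implicit Defensive.

Record sgraph := SGraph {
  vertex :> finType;
  edge : rel vertex;
  edge_sym : symmetric edge;
  edge_irrefl : irreflexive edge }.

Section TwinWidth.
Variable G : sgraph.
Implicit Types (X Y : {set G}) (P Q : {set {set G}}).

Definition singletons : {set {set G}} := [set [set x] | x : G].

Definition merge_step P Q : bool :=
  [exists X in P, exists Y in P,
     (X != Y) && (Q == (X :|: Y) |: (P :\ X :\ Y))].

(* The tuple lists P_n, ..., P_1 in this order, with n = #|G|. The default
   values of head and last only matter for the graph with no vertex, whose
   unique partition sequence is the empty one. *)
Definition partition_sequence (s : #|G|.-tuple {set {set G}}) : bool :=
  [&& all (fun P => partition P [set: G]) s,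
      head singletons s == singletons,
      last [set [set: G]] s == [set [set: G]]
    & sorted merge_step s].

Definition homogeneous X Y : bool :=
  [forall x in X, forall y in Y, edge x y] ||
  [forall x in X, forall y in Y, ~~ edge x y].

Definition red_edge X Y : bool := (X != Y) && ~~ homogeneous X Y.

Definition red_arc X Y : bool :=
  (X != Y) &&
  [exists y in Y, [exists x in X, edge y x] && [exists x in X, ~~ edge y x]].

(* Maximum (out-)degree of the (di)graph with vertex set P and adjacency r. *)
Definition max_degree (r : rel {set G}) P : nat :=
  \max_(X in P) #|[set Y in P | r X Y]|.

Definition width (r : rel {set G}) (s : #|G|.-tuple {set {set G}}) : nat :=
  \max_(P <- s) max_degree r P.

Definition has_width (r : rel {set G}) (k : nat) : bool :=
  [exists s : #|G|.-tuple {set {set G}},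
     partition_sequence s && (width r s == k)].

Lemma partition_singletons : partition singletons [set: G].
Proof.
apply/and3P; split.
- apply/eqP/setP => x; rewrite inE; apply/bigcupP.
  by exists [set x]; rewrite ?inE // imset_f.
- apply/trivIsetP => _ _ /imsetP[x _ ->] /imsetP[y _ ->] ne.
  rewrite disjoints1 inE; apply: contraNneq ne => xy; by rewrite xy.
- by apply/imsetP => -[x _ /setP/(_ x)]; rewrite !inE eqxx.
Qed.

Lemma card_singletons : #|singletons| = #|G|.
Proof. by rewrite card_imset //; exact: set1_inj. Qed.

Lemma partition_merge P X Y : partition P [set: G] -> X \in P -> Y \in P ->
  X != Y -> let Q := (X :|: Y) |: (P :\ X :\ Y) in
  partition Q [set: G] /\ #|P| = #|Q|.+1.
Proof.
move=> /and3P[/eqP cP tP P0] XP YP neq /=; have dis := trivIsetP tP.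
have YPX : Y \in P :\ X by rewrite !inE eq_sym neq.
have XN0 : X != set0 by apply: contraNneq P0 => <-.
have disU Z : Z \in P :\ X :\ Y -> [disjoint X :|: Y & Z].
  rewrite !inE => /and3P[ZY ZX ZP].
  by rewrite -setI_eq0 setIUl setU_eq0 !setI_eq0 !dis // eq_sym.
have notin : X :|: Y \notin P :\ X :\ Y.
  apply/negP => /disU; rewrite -setI_eq0 setIid setU_eq0.
  by rewrite (negbTE XN0).
split; last by rewrite cardsU1 notin (cardsD1 X P) XP (cardsD1 Y (P :\ X)) YPX.
apply/and3P; split.
- apply/eqP/setP => x; rewrite inE; apply/bigcupP.
  have : x \in cover P by rewrite cP inE.
  case/bigcupP => Z ZP xZ.
  case: (altP (Z =P X)) => [ZX|ZX].
    by exists (X :|: Y); rewrite !inE ?eqxx // -ZX xZ.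
  case: (altP (Z =P Y)) => [ZY|ZY].
    by exists (X :|: Y); rewrite !inE ?eqxx // -ZY xZ orbT.
  by exists Z => //; rewrite !inE ZX ZY ZP orbT.
- apply/trivIsetP => A B /setU1P[->|AP] /setU1P[->|BP] ne.
  + by rewrite eqxx in ne.
  + exact: disU.
  + by rewrite disjoint_sym disU.
  + by move: AP BP; rewrite !inE => /and3P[_ _ AP] /and3P[_ _ BP]; apply: dis.
- rewrite !inE (negbTE P0) !andbF orbF eq_sym setU_eq0.
  by rewrite (negbTE XN0).
Qed.

Lemma merge_path k P : partition P [set: G] -> #|P| = k.+1 ->
  exists2 s : seq {set {set G}}, size s = k &
    [/\ all (fun Q => partition Q [set: G]) s,
        last P s = [set [set: G]] & path merge_step P s].
Proof.
elim: k P => [|k IHk] P pP cardP.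
  exists [::] => //; split=> //=; move/eqP/cards1P: cardP => [X PX].
  by move: (cover_partition pP); rewrite PX /cover big_set1 => ->.
have /card_gt1P[X [Y [XP YP neq]]] : 1 < #|P| by rewrite cardP.
have [pQ] := partition_merge pP XP YP neq; set Q := _ |: _ in pQ *.
rewrite cardP => -[/esym cardQ].
have [s ss [a l p]] := IHk Q pQ cardQ.
exists (Q :: s); rewrite /= ?ss //; split=> //=; first by rewrite pQ.
rewrite p andbT; apply/existsP; exists X; rewrite XP /=.
by apply/existsP; exists Y; rewrite YP neq /=.
Qed.

Lemma partition_sequence_exists :
  exists s : #|G|.-tuple {set {set G}}, partition_sequence s.
Proof.
suff [s ss ps] : exists2 s : seq {set {set G}}, size s == #|G| &
    [&& all (fun P => partition P [set: G]) s, head singletons s == singletons,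
      last [set [set: G]] s == [set [set: G]] & sorted merge_step s].
  by exists (Tuple ss).
case E: #|G| => [|k]; first by exists [::]; rewrite //= !eqxx.
have [s ss [a l p]] :=
  merge_path partition_singletons (etrans card_singletons E).
by exists (singletons :: s); rewrite /= ?ss // partition_singletons a l p !eqxx.
Qed.

Lemma has_width_exists r : exists k, has_width r k.
Proof.
have [s ps] := partition_sequence_exists; exists (width r s).
by apply/existsP; exists s; rewrite ps /=.
Qed.

Definition tww : nat := ex_minn (has_width_exists red_edge).

Definition otww : nat := ex_minn (has_width_exists red_arc).

End TwinWidth.

(* Main.v *)
Require Import Defs.
From mathcomp Require Import all_boot.

Set Implicit Arguments.
Unset Strict Implicit.
Unset Printing Implicit Defensive.

(** A red arc is in particular a red edge, so otww <= tww.  Conversely, take a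
    partition sequence whose directed red graphs have out-degree at most d, and
    call two parts X, Y mixed if X -> Y and Y -> X.  Split every part X of each
    partition according to the adjacencies towards the parts Y that are not
    mixed with X.  Only the out-neighbours Y of X with no arc Y -> X matter, and
    each vertex of X is homogeneous to such a Y, so X is split into at most 2^d
    classes.  Classes inside distinct non-mixed parts are homogeneous, hence the
    red degree is at most (d + 1) 2^d.  The split partitions become coarser
    along the sequence, and interpolating between consecutive ones by arbitrary
    merges costs at most a factor 2. *)

(** * Fibres of maps and sizes of images *)

Definition finer (S T U : Type) (f : S -> T) (g : S -> U) : Prop :=
  forall x y, f x = f y -> g x = g y.

Lemma card_imset_finer (S T U : finType) (f : S -> T) (g : S -> U)
    (A : {set S}) :
  {in A &, finer f g} -> #|g @: A| <= #|f @: A|.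
Proof.
move=> fg; have [->|[x0 _]] := set_0Vmem A; first by rewrite !imset0 cards0.
(* On [A], [g] factors through [f]: [h] picks a preimage in [A]. The default [x0] only makes [h]
   total. *)
pose h t := g (odflt x0 [pick x in A | f x == t]).
suff /subset_leq_card gh : g @: A \subset h @: (f @: A).
  exact: leq_trans gh (leq_imset_card _ _).
apply/subsetP => _ /imsetP[x xA ->]; apply/imsetP; exists (f x).
  exact: imset_f.
rewrite /h; case: pickP => [y /andP[yA /eqP fy]|/(_ x)] /=.
  exact/esym/fg.
by rewrite xA eqxx.
Qed.

Lemma card_bigcup_leq (S T : finType) (A : {set S}) (F : S -> {set T}) k :
  (forall x, x \in A -> #|F x| <= k) -> #|\bigcup_(x in A) F x| <= #|A| * k.
Proof.
move=> Fk; rewrite -sum_nat_const.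
apply: (big_ind2 (fun (B : {set T}) n => #|B| <= n)) => //.
  by rewrite cards0.
move=> B m C n Bm Cn; apply: leq_trans (leq_add Bm Cn).
exact: leq_card_setU.
Qed.

(** * Partitions through their block maps *)

Section FullPartition.
Variable T : finType.
Implicit Types P Q : {set {set T}}.

Lemma partition_trivIset P : partition P [set: T] -> trivIset P.
Proof. by case/and3P. Qed.

Lemma mem_cover_partition P x : partition P [set: T] -> x \in cover P.
Proof. by move=> pP; rewrite (cover_partition pP) inE. Qed.

Lemma mem_pblock_partition P x : partition P [set: T] -> x \in pblock P x.
Proof. by move=> pP; rewrite mem_pblock mem_cover_partition. Qed.

Lemma pblock_partition_mem P x : partition P [set: T] -> pblock P x \in P.
Proof. by move=> pP; rewrite pblock_mem ?mem_cover_partition. Qed.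

Lemma pblock_partitionE P X x :
  partition P [set: T] -> X \in P -> x \in X -> pblock P x = X.
Proof. by move=> pP; apply/def_pblock/partition_trivIset. Qed.

Lemma in_pblock_partition P x y :
  partition P [set: T] -> (y \in pblock P x) = (pblock P x == pblock P y).
Proof.
by move=> pP; rewrite eq_pblock ?partition_trivIset ?mem_cover_partition.
Qed.

Lemma partition_part_neq0 P X :
  partition P [set: T] -> X \in P -> exists x, x \in X.
Proof. by move=> /and3P[_ _ P0] XP; apply/set0Pn; apply: contraNneq P0 => <-. Qed.

Lemma partition_eqP P Q : partition P [set: T] -> partition Q [set: T] ->
  finer (pblock P) (pblock Q) -> finer (pblock Q) (pblock P) -> P = Q.
Proof.
move=> pP pQ PQ QP.
rewrite -(equivalence_partition_pblock pP) -(equivalence_partition_pblock pQ).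
apply: eq_imset => x; apply/setP => y; rewrite !inE /=.
rewrite !in_pblock_partition //.
by apply/eqP/eqP => [/PQ|/QP].
Qed.

Lemma pblock_preim_partition (rT : eqType) (f : T -> rT) x y :
  (pblock (preim_partition f setT) x == pblock (preim_partition f setT) y)
  = (f x == f y).
Proof.
rewrite -in_pblock_partition; last exact: preim_partitionP.
rewrite pblock_equivalence_partition ?inE //.
by move=> u v w _ _ _ /=; split=> // /eqP ->.
Qed.

End FullPartition.

(** * Interpolating between nested partitions by merges *)

Section OrientedRefinement.
Variable G : sgraph.
Implicit Types (X Y Z : {set G}) (P Q R : {set {set G}}).

Lemma merge_stepP P Q : reflect
  (exists X Y, [/\ X \in P, Y \in P, X != Y & Q = (X :|: Y) |: (P :\ X :\ Y)])
  (merge_step P Q).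
Proof.
apply: (iffP existsP) => [[X /andP[XP /existsP[Y]]]|[X [Y [XP YP neq QE]]]].
  by move=> /and3P[YP neq /eqP]; exists X, Y.
by exists X; rewrite XP; apply/existsP; exists Y; rewrite YP neq QE /=.
Qed.

(** Induction on the number of parts: as long as the partitions differ, two parts of [P] lie in one
    part of [Q], and merging them keeps the result finer than [Q]. The sandwich on each intermediate
    [R] is what the degree bound consumes. *)
Lemma merge_path_to P Q : partition P [set: G] -> partition Q [set: G] ->
  finer (pblock P) (pblock Q) ->
  exists s, [/\ path (@merge_step G) P s, last P s = Q &
    forall R, R \in s -> [/\ partition R [set: G], finer (pblock P) (pblock R)
                           & finer (pblock R) (pblock Q)]].
Proof.
move=> + pQ; have [n] := ubnP #|P|; elim: n P => // n IHn P ltPn pP PQ.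
have [QP|] := boolP [forall x, forall y,
    (pblock Q x == pblock Q y) ==> (pblock P x == pblock P y)].
  exists [::]; split=> //=; apply: partition_eqP => // x y /eqP Qxy.
  by apply/eqP; move/forallP/(_ x)/forallP/(_ y): QP; rewrite Qxy.
case/forallPn=> x /forallPn[y]; rewrite negb_imply => /andP[/eqP Qxy neq].
have xP := pblock_partition_mem x pP; have yP := pblock_partition_mem y pP.
have [] := partition_merge pP xP yP neq; set R := _ |: _ => pR cardR.
have PR u : pblock R u = if pblock P u \in [set pblock P x; pblock P y]
    then pblock P x :|: pblock P y else pblock P u.
  have uu := mem_pblock_partition u pP.
  case: ifP; rewrite !inE => Pu; apply: pblock_partitionE => //.
  - by rewrite !inE eqxx.
  - by case/orP: Pu => /eqP <-; rewrite inE uu ?orbT.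
  - by rewrite !inE; have [-> ->] := norP (negbT Pu); rewrite pblock_partition_mem ?orbT.
have fPR : finer (pblock P) (pblock R) by move=> u v Puv; rewrite !PR Puv.
have fRQ : finer (pblock R) (pblock Q).
  have side u : u \in pblock P x :|: pblock P y -> pblock Q u = pblock Q x.
    by rewrite inE !in_pblock_partition // => /orP[]/eqP/PQ <-.
  move=> u v /eqP; rewrite -in_pblock_partition // PR; case: ifP => uxy vR.
    have uR : u \in pblock P x :|: pblock P y.
      move: uxy; have := mem_pblock_partition u pP.
      by rewrite !inE => uu /orP[]/eqP <-; rewrite uu ?orbT.
    by rewrite !side.
  by apply: PQ; apply/eqP; rewrite -in_pblock_partition.
have ltRn : #|R| < n by rewrite -ltnS -cardR.
have [s [ps ls Rs]] := IHn R ltRn pR fRQ.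
exists (R :: s); split=> //=.
  by rewrite ps andbT; apply/merge_stepP; exists (pblock P x), (pblock P y).
move=> S; rewrite inE => /predU1P[->|/Rs[pS RS SQ]]; split=> //.
by move=> u v /fPR/RS.
Qed.

(** * Red arcs and red edges *)

Lemma red_arcPn X Y : X != Y ->
  ~~ red_arc X Y -> forall x x' y, x \in X -> x' \in X -> y \in Y ->
  edge x y = edge x' y.
Proof.
move=> neq; rewrite /red_arc neq /= => /existsPn arc x x' y xX x'X yY.
move: (arc y); rewrite yY /= negb_and => /orP[]/existsPn no.
  have := (no x, no x'); rewrite xX x'X /= !(@edge_sym _ y).
  by case=> /negbTE-> /negbTE->.
have := (no x, no x'); rewrite xX x'X /= !negbK !(@edge_sym _ y).
by case=> -> ->.
Qed.

Lemma red_arc_edge X Y : red_arc X Y -> red_edge X Y.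
Proof.
case/andP=> neq /existsP[y /and3P[yY /existsP[x /andP[xX yx]]]].
case/existsP=> x' /andP[x'X yx']; rewrite /red_edge neq /=.
apply/norP; split; apply/forallPn.
  exists x'; rewrite x'X /=; apply/forallPn; exists y.
  by rewrite yY /= edge_sym.
exists x; rewrite xX /=; apply/forallPn; exists y.
by rewrite yY /= edge_sym negbK.
Qed.

(** The splitting vertex and its neighbor and non-neighbor survive enlargement. Contrapositively,
    when parts grow into distinct parts that are not mixed, the original ones were not mixed
    either. *)
Lemma red_arcS X X' Y Y' : X \subset X' -> Y \subset Y' -> X' != Y' ->
  red_arc X Y -> red_arc X' Y'.
Proof.
move=> /subsetP sX /subsetP sY neq; rewrite /red_arc neq /=.
case/andP=> _ /existsP[y /and3P[yY /existsP[x /andP[xX yx]]]].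
case/existsP=> x' /andP[x'X yx']; apply/existsP; exists y.
rewrite sY //=; apply/andP; split; apply/existsP; first by exists x; rewrite sX.
by exists x'; rewrite sX.
Qed.

(** * Splitting parts by signatures *)

Definition mixed X Y : bool := red_arc X Y && red_arc Y X.

Definition visible P (x y : G) : bool :=
  (pblock P x != pblock P y) && ~~ mixed (pblock P x) (pblock P y).

(** Keeping the block makes vertices with equal signatures see the same visible vertices, so that
    their traces can be compared. *)
Definition signature P (x : G) : {set G} * {set G} :=
  (pblock P x, [set y | visible P x y && edge x y]).

Definition refinement P : {set {set G}} := preim_partition (signature P) setT.

Lemma signature_edge P x x' y : signature P x = signature P x' ->
  visible P x y -> edge x y = edge x' y.
Proof.
by case=> Pxx' /setP/(_ y); rewrite !inE /visible -Pxx' => + vis; rewrite vis.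
Qed.

(** The signature on [X] is determined by which out-neighbors of [X] contain a neighbor of the
    vertex. For a visible [y], either there is no arc from [X] to the block of [y], and all of [X]
    agrees on [y], or there is no arc back, and each vertex of [X] is homogeneous to that block. *)
Lemma card_signature P X d : partition P [set: G] -> X \in P ->
  #|[set Y in P | red_arc X Y]| <= d -> #|signature P @: X| <= 2 ^ d.
Proof.
move=> pP XP; set N := [set Y in P | red_arc X Y] => Nd.
pose t x := [set Y in N | [exists y in Y, edge x y]].
have tfine : {in X &, finer t (signature P)}.
  move=> x x' xX x'X txx'.
  have [Px Px'] := (pblock_partitionE pP XP xX, pblock_partitionE pP XP x'X).
  rewrite /signature /visible Px Px'; congr (_, _); apply/setP => y.
  rewrite !inE; apply: andb_id2l => /andP[neq].
  have yY := mem_pblock_partition y pP.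
  have [arc|/(red_arcPn neq) no _] := boolP (red_arc X (pblock P y));
    last exact: no.
  have neq' : pblock P y != X by rewrite eq_sym.
  rewrite /mixed arc /= => /(red_arcPn neq') no'.
  move/setP/(_ (pblock P y)): txx'.
  rewrite !inE arc pblock_partition_mem //=.
  (* By [no'], one neighbor in the block of [y] forces adjacency to [y] itself. *)
  suff E u : u \in X -> [exists z in pblock P y, edge u z] = edge u y.
    by rewrite !E.
  move=> uX; apply/existsP/idP => [[z /andP[zY]]|uy]; last first.
    by exists y; rewrite yY.
  by rewrite edge_sym (no' _ y) // edge_sym.
apply: leq_trans (card_imset_finer tfine) _.
apply: leq_trans (_ : 2 ^ #|N| <= _); last by rewrite leq_exp2l.
rewrite -card_powerset; apply: subset_leq_card; apply/subsetP => _ /imsetP[x _ ->].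
by rewrite inE; apply/subsetP => Y; rewrite inE => /andP[].
Qed.

(** * Signatures and red degrees along merges *)

Definition merged_pairs P Q : Prop :=
  forall X, X \in Q -> exists Y Z, [/\ Y \in P, Z \in P & X = Y :|: Z].

(** The two parts may coincide; the case [Q = P] serves for the first partition of the new
    sequence. *)
Lemma merged_pairs_refl P : merged_pairs P P.
Proof. by move=> X XP; exists X, X; rewrite setUid. Qed.

Lemma merge_step_pairs P Q : merge_step P Q -> merged_pairs P Q.
Proof.
case/merge_stepP=> X [Y [XP YP _ ->]] Z; rewrite !inE.
case/predU1P=> [->|/and3P[_ _ ZP]]; first by exists X, Y.
by exists Z, Z; rewrite setUid.
Qed.

Lemma merged_pairs_pblock P Q x :
  partition P [set: G] -> partition Q [set: G] -> merged_pairs P Q ->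
  pblock P x \subset pblock Q x.
Proof.
move=> pP pQ PQ; have [Y [Z [YP ZP QE]]] := PQ _ (pblock_partition_mem x pQ).
have := mem_pblock_partition x pQ; rewrite QE inE.
by case/orP=> [/(pblock_partitionE pP YP)|/(pblock_partitionE pP ZP)] ->;
  rewrite ?subsetUl ?subsetUr.
Qed.

(** Blocks only grow, so a pair visible in [Q] is already visible in [P], and the adjacencies
    recorded by [signature Q] can be read off [signature P]. *)
Lemma signature_finer P Q :
  partition P [set: G] -> partition Q [set: G] -> merged_pairs P Q ->
  finer (signature P) (signature Q).
Proof.
move=> pP pQ PQ x x' sxx'; have sub u := merged_pairs_pblock u pP pQ PQ.
have Qxx' : pblock Q x = pblock Q x'.
  apply/eqP; rewrite -in_pblock_partition //; apply: (subsetP (sub x)).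
  by case: sxx' => -> _; apply: mem_pblock_partition.
rewrite /signature /visible -Qxx'; congr (_, _); apply/setP => y; rewrite !inE.
apply: andb_id2l => /andP[neqQ nmQ]; apply: (signature_edge sxx').
apply/andP; split.
  apply: contraNneq neqQ => Pxy; rewrite -in_pblock_partition //.
  by apply: (subsetP (sub x)); rewrite Pxy mem_pblock_partition.
apply: contra nmQ => /andP[xy yx].
by rewrite /mixed (red_arcS _ _ _ xy) 1?(red_arcS _ _ _ yx) // eq_sym.
Qed.

Lemma red_edge_refinement Q R A B a b :
  partition Q [set: G] -> partition R [set: G] ->
  finer (pblock R) (signature Q) -> A \in R -> B \in R -> a \in A -> b \in B ->
  red_edge A B ->
  pblock Q b = pblock Q a \/ red_arc (pblock Q a) (pblock Q b).
Proof.
move=> pQ pR RQ AR BR aA bB /andP[neqAB /negP nhom].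
have [->|neq] := eqVneq (pblock Q b) (pblock Q a); first by left.
right; apply/negPn/negP => narc; apply: nhom.
have sA x : x \in A -> signature Q x = signature Q a.
  by move=> xA; apply: RQ; rewrite !(pblock_partitionE pR AR).
have sB y : y \in B -> signature Q y = signature Q b.
  by move=> yB; apply: RQ; rewrite !(pblock_partitionE pR BR).
have memA x : x \in A -> x \in pblock Q a.
  by case/sA=> <- _; apply: mem_pblock_partition.
have ab : visible Q b a.
  by rewrite /visible neq /mixed (negbTE narc) andbF.
(* First move [x] to [a], since [y] does not split the block of [a]; then move [y] to [b], since
   they share a signature and [a] is visible from [b]. *)
have const x y : x \in A -> y \in B -> edge x y = edge a b.
  move=> xA yB; have yQ : y \in pblock Q b.
    by case/sB: yB => <- _; apply: mem_pblock_partition.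
  rewrite (red_arcPn _ narc (memA _ xA) (memA _ aA) yQ) 1?eq_sym //.
  rewrite ![edge a _]edge_sym; apply/esym/signature_edge/ab.
  exact/esym/sB.
rewrite /homogeneous; have [eab|neab] := boolP (edge a b).
  apply/orP; left; apply/forallP => x; apply/implyP => xA.
  by apply/forallP => y; apply/implyP => yB; rewrite const.
apply/orP; right; apply/forallP => x; apply/implyP => xA.
by apply/forallP => y; apply/implyP => yB; rewrite const.
Qed.

Lemma out_degree_leq d P X : max_degree (@red_arc G) P <= d -> X \in P ->
  #|[set Y in P | red_arc X Y]| <= d.
Proof. by move=> /bigmax_leqP Pd /Pd. Qed.

(** Red neighbors of [A] lie in at most [d.+1] blocks of [Q]: its own and the out-neighbors of that
    one. Each is a union of two parts of [P], and each of these meets at most [2 ^ d] parts of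
    [R]. *)
Lemma red_degree_between d P Q R :
  partition P [set: G] -> partition Q [set: G] -> partition R [set: G] ->
  merged_pairs P Q ->
  max_degree (@red_arc G) P <= d -> max_degree (@red_arc G) Q <= d ->
  finer (signature P) (pblock R) -> finer (pblock R) (signature Q) ->
  max_degree (@red_edge G) R <= d.+1 * 2 ^ d.+1.
Proof.
move=> pP pQ pR PQ dP dQ PR RQ; apply/bigmax_leqP => A AR.
have [a aA] := partition_part_neq0 pR AR.
pose N := pblock Q a |: [set Y in Q | red_arc (pblock Q a) Y].
have cardN : #|N| <= d.+1.
  rewrite cardsU1 -add1n leq_add ?leq_b1 //.
  by rewrite out_degree_leq ?pblock_partition_mem.
have NQ Y : Y \in N -> Y \in Q.
  by rewrite !inE => /predU1P[->|/andP[//]]; apply: pblock_partition_mem.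
have cardF Y : Y \in N -> #|pblock R @: Y| <= 2 ^ d.+1.
  move=> /NQ/PQ[Y1 [Y2 [Y1P Y2P ->]]].
  have PR' : {in Y1 :|: Y2 &, finer (signature P) (pblock R)}.
    by move=> x y _ _; apply: PR.
  apply: leq_trans (card_imset_finer PR') _; rewrite imsetU.
  apply: leq_trans (leq_card_setU _ _) _; rewrite expnS mul2n -addnn.
  by rewrite leq_add ?card_signature ?out_degree_leq.
apply: leq_trans (leq_trans (card_bigcup_leq cardF) _); last first.
  by rewrite leq_mul2r cardN orbT.
apply: subset_leq_card; apply/subsetP => B; rewrite inE => /andP[BR AB].
have [b bB] := partition_part_neq0 pR BR.
apply/bigcupP; exists (pblock Q b).
  have := red_edge_refinement pQ pR RQ AR BR aA bB AB.
  by rewrite !inE pblock_partition_mem // => -[->|->]; rewrite ?eqxx ?orbT.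
apply/imsetP; exists b; first exact: mem_pblock_partition.
by rewrite (pblock_partitionE pR BR).
Qed.

(** * The refined partition sequence *)

Lemma refinement_partition P : partition (refinement P) [set: G].
Proof. exact: preim_partitionP. Qed.

Lemma refinement_pblock P x y :
  (pblock (refinement P) x == pblock (refinement P) y)
  = (signature P x == signature P y).
Proof. exact: pblock_preim_partition. Qed.

Lemma refinement_finer P : finer (pblock (refinement P)) (pblock P).
Proof. by move=> x y /eqP; rewrite refinement_pblock => /eqP[]. Qed.

Lemma refinement_singletons : refinement (singletons G) = singletons G.
Proof.
have pS := partition_singletons G.
have blockS x : pblock (singletons G) x = [set x].
  by apply: pblock_partitionE; rewrite ?imset_f ?set11.
apply: partition_eqP => //; first exact: refinement_partition.
  exact: refinement_finer.
by move=> x y; rewrite !blockS => /set1_inj ->.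
Qed.

(** With a single part nothing is visible, so all signatures agree. *)
Lemma refinement_setT :
  partition [set [set: G]] [set: G] -> refinement [set [set: G]] = [set [set: G]].
Proof.
move=> pT; have blockT x : pblock [set [set: G]] x = [set: G].
  by apply: pblock_partitionE; rewrite ?set11 ?inE.
apply: partition_eqP => //; first exact: refinement_partition.
  exact: refinement_finer.
move=> x y _; apply/eqP; rewrite refinement_pblock; apply/eqP.
congr (_, _); first by rewrite !blockT.
by apply/setP => z; rewrite !inE /visible !blockT eqxx.
Qed.

(** Concatenates interpolations between consecutive refinements. The bound omits the starting
    partition [refinement P], which is treated separately. *)
Lemma refined_path d P s :
  all (fun Q => partition Q [set: G]) (P :: s) ->
  all (fun Q => max_degree (@red_arc G) Q <= d) (P :: s) ->
  path (@merge_step G) P s -> last P s = [set [set: G]] ->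
  exists s', [/\ path (@merge_step G) (refinement P) s',
    last (refinement P) s' = [set [set: G]],
    all (fun Q => partition Q [set: G]) s' &
    all (fun Q => max_degree (@red_edge G) Q <= d.+1 * 2 ^ d.+1) s'].
Proof.
elim: s P => [|Q s IHs] P.
  move=> /= /andP[+ _] _ _ PT; rewrite PT => pT.
  by exists [::]; split=> //=; apply: refinement_setT.
move=> /= /andP[pP pQs] /andP[dP dQs] /andP[PQ ps] ls.
have [t [pt lt apt dt]] := IHs Q pQs dQs ps ls.
have [[pQ _] [dQ _]] := (andP pQs, andP dQs).
have pairs := merge_step_pairs PQ.
have [|u [pu lu uP]] :=
    merge_path_to (refinement_partition P) (refinement_partition Q).
  move=> x y /eqP; rewrite refinement_pblock => /eqP/(signature_finer pP pQ pairs).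
  by move/eqP; rewrite -refinement_pblock => /eqP.
exists (u ++ t); rewrite cat_path last_cat !all_cat lu pu pt apt dt !andbT.
split=> //; apply/allP => R /uP[pR PR RQ] //.
apply: (red_degree_between pP pQ pR pairs) => // x y.
  by move/eqP; rewrite -refinement_pblock => /eqP/PR.
by move/RQ/eqP; rewrite refinement_pblock => /eqP.
Qed.

(** Each merge removes exactly one part; this gives the new sequence its required length [#|G|]. *)
Lemma merge_path_card P s : partition P [set: G] -> path (@merge_step G) P s ->
  #|P| = size s + #|last P s|.
Proof.
elim: s P => //= Q s IHs P pP /andP[/merge_stepP[X [Y [XP YP neq QE]]] ps].
have [] := partition_merge pP XP YP neq; rewrite -QE => pQ ->.
by rewrite (IHs Q).
Qed.

Lemma width_leqP r k (s : #|G|.-tuple {set {set G}}) :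
  reflect (forall P, P \in s -> max_degree r P <= k) (width r s <= k).
Proof.
apply: (iffP idP) => [le P Ps|le]; first exact: leq_trans (leq_bigmax_seq _ Ps _) le.
by apply/bigmax_leqP_seq => P /le.
Qed.

Lemma refined_sequence d (s : #|G|.-tuple {set {set G}}) :
  partition_sequence s -> width (@red_arc G) s <= d ->
  exists2 s' : #|G|.-tuple {set {set G}},
    partition_sequence s' & width (@red_edge G) s' <= d.+1 * 2 ^ d.+1.
Proof.
move=> ps /width_leqP sd.
case E: (val s) => [|P t].
  (* The graph has no vertex, and the empty sequence has width 0. *)
  by exists s => //; apply/width_leqP => P; rewrite memtE E.
case/and4P: ps; rewrite E /= => /andP[pP pt] /eqP PE /eqP lt mt.
have dPt : all (fun Q => max_degree (@red_arc G) Q <= d) (P :: t).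
  by apply/allP => Q Qs; apply: sd; rewrite memtE E.
have [|u [pu lu au du]] := refined_path _ dPt mt lt; first by rewrite /= pP.
have dP : max_degree (@red_arc G) P <= d by case/andP: dPt.
rewrite PE refinement_singletons in pu lu.
have sz : size (singletons G :: u) == #|G|.
  have pS := partition_singletons G.
  by rewrite -card_singletons (merge_path_card pS pu) lu cards1 addn1.
exists (Tuple sz).
  by rewrite /partition_sequence /= partition_singletons au lu !eqxx.
apply/width_leqP => R; rewrite memtE /= inE => /predU1P[->|/(allP du)//].
(* The head is the refinement of [P], sandwiched between [P] and [P] itself. *)
rewrite -refinement_singletons -PE.
apply: (red_degree_between pP pP (refinement_partition P)) => //.
- exact: merged_pairs_refl.
- by move=> x y /eqP; rewrite -refinement_pblock => /eqP.
- by move=> x y /eqP; rewrite refinement_pblock => /eqP.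
Qed.

(** * Comparing the two parameters *)

Lemma otww_sequence :
  exists2 s, partition_sequence s & width (@red_arc G) s = otww G.
Proof.
rewrite /otww; case: ex_minnP => k /existsP[s /andP[ps /eqP <-]] _.
by exists s.
Qed.

Lemma tww_sequence :
  exists2 s, partition_sequence s & width (@red_edge G) s = tww G.
Proof.
rewrite /tww; case: ex_minnP => k /existsP[s /andP[ps /eqP <-]] _.
by exists s.
Qed.

Lemma otww_min s : partition_sequence s -> otww G <= width (@red_arc G) s.
Proof.
move=> ps; rewrite /otww; case: ex_minnP => k _; apply.
by apply/existsP; exists s; rewrite ps /=.
Qed.

Lemma tww_min s : partition_sequence s -> tww G <= width (@red_edge G) s.
Proof.
move=> ps; rewrite /tww; case: ex_minnP => k _; apply.
by apply/existsP; exists s; rewrite ps /=.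
Qed.

Lemma otww_leq_tww : otww G <= tww G.
Proof.
have [s ps sE] := tww_sequence; apply: leq_trans (otww_min ps) _.
apply/width_leqP => P Ps; apply/bigmax_leqP => X XP.
have /width_leqP/(_ P Ps)/bigmax_leqP/(_ X XP) := leqnn (width (@red_edge G) s).
rewrite sE; apply: leq_trans; apply: subset_leq_card; apply/subsetP => Y.
by rewrite !inE => /andP[-> /red_arc_edge].
Qed.

Lemma tww_leq_otww : tww G <= (otww G).+1 * 2 ^ (otww G).+1.
Proof.
have [s ps sE] := otww_sequence.
have [|s' ps' s'd] := refined_sequence (d := otww G) ps; first by rewrite sE.
exact: leq_trans (tww_min ps') s'd.
Qed.

End OrientedRefinement.

Theorem theorem1p3 :
  exists f : nat -> nat, forall G : sgraph,
    otww G <= f (tww G) /\ tww G <= f (otww G).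
Proof.
(* The bound for [tww] also serves for [otww], since it is at least [d]. *)
exists (fun d => d.+1 * 2 ^ d.+1) => G; split; last exact: tww_leq_otww.
apply: leq_trans (otww_leq_tww G) (leq_trans (leqnSn _) _).
by rewrite leq_pmulr // expn_gt0.
Qed.
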